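(* Let $L$ be a quantum Latin square over a finite quantum space $X$ and let $n:=\eta^\dagger\eta=\dim C(X)$. Then the adjacency matrix $$A=I\otimes J+J\otimes I+L^\dagger L-3\,I\otimes I$$ defines a strongly regular quantum graph over the quantum space $X\times X$ with parameters $(n^2,\,3(n-1),\,n,\,6)$.
   Context: All algebras are unital over $\mathbb C$. A finite quantum space $X$ is given by a nonzero finite-dimensional $*$-algebra $C(X)$ with a positive linear functional $\psi$ such that $(a,b)\mapsto\psi(ab)$ is non-degenerate, $\psi(ab)=\psi(ba)$, and $mm^\dagger=\mathrm{id}$, where $m$ is the multiplication and $\dagger$ is the adjoint with respect to $\langle a,b\rangle=\psi(a^*b)$ (and the induced inner product on tensor powers). $l^2(X)$ is $C(X)$ with this inner product; $\eta$ is the unit (as a map $\mathbb C\to l^2(X)$ or a vector), so $\eta^\dagger=\psi$ and $\eta^\dagger\eta=\dim C(X)$. For $A,B\in\mathscr L(l^2(X))$: $A^\dagger$ is the adjoint, $A^*(f):=(A(f^* ))^*$, $A\bullet B:=m(A\otimes B)m^\dagger$ (Schur product), $I$ is the identity, $J:=\eta\eta^\dagger$. $X\times X$ is the finite quantum space with $C(X\times X)=C(X)\otimes C(X)$ with entrywise operations: $(x_1\otimes y_1)(x_2\otimes y_2)=x_1x_2\otimes y_1y_2$, $(x\otimes y)^*=x^*\otimes y^*$, and functional $\psi\otimes\psi$. In the formula for $A$, $I$ and $J$ are the operators on $l^2(X)$. A simple quantum graph on a finite quantum space is given by an operator $A$ with $A\bullet A=A=A^*$, $A=A^\dagger$, $A\bullet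 I=0=I\bullet A$. It is strongly regular with parameters $(n,k,\lambda,\mu)$ if $\eta^\dagger\eta=n$ and $A^2=kI+\lambda A+\mu(J-I-A)$ (with $\eta,I,J$ of the space on which the graph lives). A quantum Latin square on $X$ is a linear map $L\colon l^2(X)\otimes l^2(X)\to l^2(X)$ such that: (1) $L(x^*\otimes y^* )=L(x\otimes y)^*$ for all $x,y$; (2) $m^\dagger L=(L\otimes L)(\mathrm{id}\otimes\Sigma\otimes\mathrm{id})(m^\dagger\otimes m^\dagger)$, where $\Sigma(x\otimes y)=y\otimes x$, and $\eta^\dagger L=\eta^\dagger\otimes\eta^\dagger$; (3) $L(\eta\otimes x)=\eta\,\eta^\dagger(x)=L(x\otimes\eta)$ for all $x\in l^2(X)$. *)

(* Defs.v *)
From HB Require Import structures.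
From mathcomp Require Import all_boot all_order all_algebra all_field.
From mathcomp Require Import spectral.

Set Implicit Arguments.
Unset Strict Implicit.
Unset Printing Implicit Defensive.

Import Order.TTheory GRing.Theory Num.Theory.
Local Open Scope ring_scope.

Reserved Notation "x \ox y" (at level 40, left associativity).

Section Basis.
Variables (K : fieldType) (V : vectType K).
Definition bas (i : 'I_(\dim {:V})) : V := (vbasis {:V})`_i.
Definition crd (i : 'I_(\dim {:V})) (v : V) : K := coord (vbasis {:V}) i v.

Lemma crd_bas i j : crd i (bas j) = (i == j)%:R.
Proof. by rewrite /crd /bas coord_free 1?eq_sym // (basis_free (vbasisP _)). Qed.

Lemma bas_crd v : v = \sum_i crd i v *: bas i.
Proof. exact: coord_vbasis (memvf v). Qed.

Lemma crd_is_scalar i : scalar (crd i).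
Proof. by move=> a u v; rewrite /crd linearP. Qed.
HB.instance Definition _ i := GRing.isLinear.Build K V K *%R (crd i) (crd_is_scalar i).
End Basis.

(* U (x) V, encoded by coordinates in the bases vbasis {:U} and vbasis {:V};
   the encoding is only seen through tens, tens_ind and tliftE. *)
Definition tensor (K : fieldType) (U V : vectType K) : predArgType :=
  'M[K]_(\dim {:U}, \dim {:V}).
HB.instance Definition _ (K : fieldType) (U V : vectType K) :=
  Vector.copy (tensor U V) 'M[K]_(\dim {:U}, \dim {:V}).

Definition tens (K : fieldType) (U V : vectType K) (u : U) (v : V) : tensor U V :=
  \matrix_(i, j) (crd i u * crd j v).
Notation "u \ox v" := (tens u v) : ring_scope.

(* The linear map on the tensor product induced by a bilinear map f. *)
Definition tlift (K : fieldType) (U V W : vectType K) (f : U -> V -> W)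
    (M : tensor U V) : W :=
  \sum_i \sum_j (M : 'M_(_, _)) i j *: f (bas i) (bas j).

Section Tensor.
Variables (K : fieldType) (U V W : vectType K).

Lemma tensDl (u u' : U) (v : V) : (u + u') \ox v = u \ox v + u' \ox v.
Proof. by apply/matrixP=> i j; rewrite !mxE linearD mulrDl. Qed.
Lemma tensDr (u : U) (v v' : V) : u \ox (v + v') = u \ox v + u \ox v'.
Proof. by apply/matrixP=> i j; rewrite !mxE linearD mulrDr. Qed.
Lemma tensZl a (u : U) (v : V) : (a *: u) \ox v = a *: (u \ox v).
Proof. by apply/matrixP=> i j; rewrite !mxE linearZ -mulrA. Qed.
Lemma tensZr a (u : U) (v : V) : u \ox (a *: v) = a *: (u \ox v).
Proof. by apply/matrixP=> i j; rewrite !mxE linearZ mulrCA. Qed.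

Lemma tens_ind (P : tensor U V -> Prop) :
  P 0 -> (forall M N, P M -> P N -> P (M + N)) -> (forall u v, P (u \ox v)) ->
  forall M, P M.
Proof.
move=> P0 PD Pt M.
suff -> : M = \sum_i \sum_j ((M : 'M_(_, _)) i j *: bas i) \ox bas j.
  by do 2![apply: big_ind => // ? _].
apply/matrixP=> k l.
have out i : i != k -> (\sum_j ((M : 'M_(_, _)) i j *: bas i) \ox bas j
    : 'M_(_, _)) k l = 0.
  move=> ik; rewrite summxE big1 // => j _.
  by rewrite !mxE linearZ /= !crd_bas (eq_sym k) (negPf ik) mulr0 mul0r.
have inn j : j != l -> (((M : 'M_(_, _)) k j *: bas k) \ox bas j
    : 'M_(_, _)) k l = 0.
  by move=> jl; rewrite !mxE !crd_bas (eq_sym l) (negPf jl) mulr0.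
rewrite summxE (bigD1 k) //= [X in _ + X]big1 // addr0.
rewrite summxE (bigD1 l) //= [X in _ + X]big1 // addr0.
by rewrite !mxE linearZ /= !crd_bas !eqxx !mulr1.
Qed.

Lemma tlift_is_linear (f : U -> V -> W) : linear (tlift f).
Proof.
move=> a M N; rewrite /tlift scaler_sumr -big_split /=; apply: eq_bigr => i _.
rewrite scaler_sumr -big_split /=; apply: eq_bigr => j _.
by rewrite !mxE scalerDl scalerA.
Qed.
HB.instance Definition _ f :=
  GRing.isLinear.Build K (tensor U V) W _ (tlift f) (tlift_is_linear f).

Lemma tliftE (f : U -> V -> W) u v :
  (forall y, linear (f^~ y)) -> (forall x, linear (f x)) ->
  tlift f (u \ox v) = f u v.
Proof.
move=> fl fr.
pose fL y := GRing.isLinear.Build K U W _ (f^~ y) (fl y).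
pose fLl y : {linear U -> W} := HB.pack (f^~ y) (fL y).
pose fR x := GRing.isLinear.Build K V W _ (f x) (fr x).
pose fRl x : {linear V -> W} := HB.pack (f x) (fR x).
have el y : f u y = \sum_i crd i u *: f (bas i) y.
  rewrite {1}(bas_crd u); have /= -> := linear_sum (fLl y).
  by apply: eq_bigr => i _; have /= -> := linearZ_LR (fLl y).
have er x : f x v = \sum_i crd i v *: f x (bas i).
  rewrite {1}(bas_crd v); have /= -> := linear_sum (fRl x).
  by apply: eq_bigr => i _; have /= -> := linearZ_LR (fRl x).
rewrite el; apply: eq_bigr => i _; rewrite er scaler_sumr.
by apply: eq_bigr => j _; rewrite scalerA mxE.
Qed.

Lemma eq_tens_linear (f g : {linear tensor U V -> W}) :
  (forall u v, f (u \ox v) = g (u \ox v)) -> f =1 g.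
Proof.
move=> fg; apply: tens_ind => [|M N IM IN|//]; first by rewrite !linear0.
by rewrite !linearD IM IN.
Qed.

Lemma eq_tens_lfun (f g : 'Hom(tensor U V, W)) :
  (forall u v, f (u \ox v) = g (u \ox v)) -> f = g.
Proof. by move=> fg; apply/lfunP; apply: eq_tens_linear. Qed.
End Tensor.

Definition tensf (K : fieldType) (U V U' V' : vectType K)
    (f : 'Hom(U, U')) (g : 'Hom(V, V')) : 'Hom(tensor U V, tensor U' V') :=
  linfun (tlift (fun u v => f u \ox g v)).
Notation "f \ox g" := (tensf f g) : lfun_scope.

Section TensorMaps.
Variables (K : fieldType).

Lemma tensfE (U V U' V' : vectType K) (f : 'Hom(U, U')) (g : 'Hom(V, V')) u v :
  (f \ox g)%VF (u \ox v) = f u \ox g v.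
Proof.
rewrite lfunE /= tliftE // => [y a x x'|x a y y'].
  by rewrite linearP tensDl tensZl.
by rewrite linearP tensDr tensZr.
Qed.

(* The map id (x) Sigma (x) id with Sigma (v (x) w) = w (x) v, up to
   reassociating the four factors: see midswapE. *)
Definition midswap (U V W Z : vectType K) :
    'Hom(tensor (tensor U V) (tensor W Z), tensor (tensor U W) (tensor V Z)) :=
  linfun (tlift (fun (p : tensor U V) (q : tensor W Z) =>
    tlift (fun u v => tlift (fun w z => (u \ox w) \ox (v \ox z)) q) p)).

Lemma midswapE (U V W Z : vectType K) (u : U) (v : V) (w : W) (z : Z) :
  midswap U V W Z ((u \ox v) \ox (w \ox z)) = (u \ox w) \ox (v \ox z).
Proof.
have linu (v' : V) (q : tensor W Z) : linear (fun u' : U =>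
    tlift (fun (w : W) (z : Z) => (u' \ox w) \ox (v' \ox z)) q).
  move=> a x y; rewrite /tlift scaler_sumr -big_split /=; apply: eq_bigr => i _.
  rewrite scaler_sumr -big_split /=; apply: eq_bigr => j _.
  by rewrite !tensDl !tensZl scalerDr !scalerA mulrC.
have linv (u' : U) (q : tensor W Z) : linear (fun v' : V =>
    tlift (fun (w : W) (z : Z) => (u' \ox w) \ox (v' \ox z)) q).
  move=> a x y; rewrite /tlift scaler_sumr -big_split /=; apply: eq_bigr => i _.
  rewrite scaler_sumr -big_split /=; apply: eq_bigr => j _.
  by rewrite !tensDl tensDr !tensZl tensZr scalerDr !scalerA mulrC.
rewrite lfunE /= !tliftE //.
- by move=> z' a x y; rewrite tensDr tensDl tensZr tensZl.
- by move=> w' a x y; rewrite tensDr tensDr tensZr tensZr.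
- by move=> q; exact: tlift_is_linear.
move=> p a x y; rewrite {1 3 5}/tlift scaler_sumr -big_split /=.
apply: eq_bigr => i _; rewrite scaler_sumr -big_split /=; apply: eq_bigr => j _.
by rewrite tlift_is_linear scalerDr !scalerA mulrC.
Qed.
End TensorMaps.

Section TensorAlgebra.
Variables (K : fieldType) (X Y : falgType K).
Notation XY := (tensor X Y).

Definition tensor_mul (M N : XY) : XY :=
  tlift (fun x1 y1 => tlift (fun x2 y2 => (x1 * x2) \ox (y1 * y2)) N) M.

Fact tensor_mulDl N : linear (tensor_mul^~ N).
Proof. exact: tlift_is_linear. Qed.

Fact tensor_mulDr M : linear (tensor_mul M).
Proof.
move=> a N N'; rewrite /tensor_mul {1 3 5}/tlift scaler_sumr -big_split /=.
apply: eq_bigr => i _; rewrite scaler_sumr -big_split /=; apply: eq_bigr => j _.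
by rewrite tlift_is_linear scalerDr !scalerA mulrC.
Qed.

Lemma tensor_mulE (x x' : X) (y y' : Y) :
  tensor_mul (x \ox y) (x' \ox y') = (x * x') \ox (y * y').
Proof.
rewrite /tensor_mul tliftE ?tliftE //.
- by move=> z a u v; rewrite mulrDr -scalerAr tensDl tensZl.
- by move=> z a u v; rewrite mulrDr -scalerAr tensDr tensZr.
- move=> z a u v; rewrite /tlift scaler_sumr -big_split /=.
  apply: eq_bigr => i _; rewrite scaler_sumr -big_split /=; apply: eq_bigr => j _.
  by rewrite mulrDl -scalerAl tensDl tensZl scalerDr !scalerA mulrC.
- move=> z a u v; rewrite /tlift scaler_sumr -big_split /=.
  apply: eq_bigr => i _; rewrite scaler_sumr -big_split /=; apply: eq_bigr => j _.
  by rewrite mulrDl -scalerAl tensDr tensZr scalerDr !scalerA mulrC.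
Qed.

Let mDl M M' N : tensor_mul (M + M') N = tensor_mul M N + tensor_mul M' N.
Proof. by have := tensor_mulDl N 1 M M'; rewrite !scale1r. Qed.
Let mDr M N N' : tensor_mul M (N + N') = tensor_mul M N + tensor_mul M N'.
Proof. by have := tensor_mulDr M 1 N N'; rewrite !scale1r. Qed.
Let m0l N : tensor_mul 0 N = 0.
Proof. by have := tensor_mulDl N (-1) 0 0; rewrite !scaleN1r !addNr. Qed.
Let m0r N : tensor_mul N 0 = 0.
Proof. by have := tensor_mulDr N (-1) 0 0; rewrite !scaleN1r !addNr. Qed.
Let mZl a M N : a *: tensor_mul M N = tensor_mul (a *: M) N.
Proof. by have := tensor_mulDl N a M 0; rewrite !addr0 m0l addr0. Qed.
Let mZr a M N : a *: tensor_mul M N = tensor_mul M (a *: N).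
Proof. by have := tensor_mulDr M a N 0; rewrite !addr0 m0r addr0. Qed.

Fact tensor_mulA : associative tensor_mul.
Proof.
move=> M N P; elim/tens_ind: M => [|M M' IH IH'|x y].
- by rewrite !m0l.
- by rewrite !mDl IH IH'.
elim/tens_ind: N => [|N N' IH IH'|x' y'].
- by rewrite !(m0l, m0r).
- by rewrite !(mDl, mDr) IH IH'.
elim/tens_ind: P => [|P P' IH IH'|x'' y''].
- by rewrite !m0r.
- by rewrite !mDr IH IH'.
by rewrite !tensor_mulE !mulrA.
Qed.

Definition tensor_one : XY := 1 \ox 1.

Fact tensor_mul1l : left_id tensor_one tensor_mul.
Proof.
elim/tens_ind => [|M M' IH IH'|x y].
- by rewrite m0r.
- by rewrite mDr IH IH'.
by rewrite tensor_mulE !mul1r.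
Qed.

Fact tensor_mul1r : right_id tensor_one tensor_mul.
Proof.
elim/tens_ind => [|M M' IH IH'|x y].
- by rewrite m0l.
- by rewrite mDl IH IH'.
by rewrite tensor_mulE !mulr1.
Qed.

Lemma tens_eq0 (U V : vectType K) (u : U) (v : V) :
  (u \ox v == 0) = (u == 0) || (v == 0).
Proof.
apply/eqP/orP => [uv0|[]/eqP->]; last 2 first.
- by apply/matrixP=> i j; rewrite !mxE linear0 mul0r.
- by apply/matrixP=> i j; rewrite !mxE linear0 mulr0.
case: (eqVneq u 0) => [|u0]; [by left | right].
rewrite (bas_crd v) big1 // => j _.
suff -> : crd j v = 0 by rewrite scale0r.
apply: contra_neq_eq u0 => vj0; rewrite (bas_crd u) big1 // => i _.
have /matrixP/(_ i j)/eqP := uv0.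
by rewrite !mxE mulf_eq0 (negPf vj0) orbF => /eqP->; rewrite scale0r.
Qed.

Fact tensor_one_neq0 : tensor_one != 0.
Proof. by rewrite tens_eq0 !oner_eq0. Qed.

HB.instance Definition _ := GRing.Zmodule_isNzRing.Build XY
  tensor_mulA tensor_mul1l tensor_mul1r mDl mDr tensor_one_neq0.
HB.instance Definition _ := GRing.Lmodule_isLalgebra.Build K XY mZl.
HB.instance Definition _ := GRing.Lalgebra_isAlgebra.Build K XY mZr.
HB.instance Definition _ := Algebra_isFalgebra.Build K XY.

Lemma tensM (x x' : X) (y y' : Y) :
  (x \ox y) * (x' \ox y') = (x * x') \ox (y * y').
Proof. exact: tensor_mulE. Qed.

Lemma tens1 : 1 \ox 1 = 1 :> XY. Proof. by []. Qed.
End TensorAlgebra.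

HB.mixin Record isStarAlgebra (C : numClosedFieldType) X of Falgebra C X := {
  star : X -> X;
  star_conjlinear : forall (a : C) (x y : X),
    star (a *: x + y) = a^* *: star x + star y;
  starM : forall x y : X, star (x * y) = star y * star x;
  starK : involutive star
}.
#[short(type="starAlgType")]
HB.structure Definition StarAlgebra (C : numClosedFieldType) :=
  { X of isStarAlgebra C X & Falgebra C X }.

HB.mixin Record hasFaithfulTrace (C : numClosedFieldType) X
    of StarAlgebra C X := {
  psi : X -> C;
  psi_scalar : scalar psi;
  psi_ge0 : forall x : X, 0 <= psi (star x * x);
  psi_nondeg : forall x : X, (forall y, psi (x * y) = 0) -> x = 0;
  psiC : forall x y : X, psi (x * y) = psi (y * x)
}.
#[short(type="tracialAlgType")]
HB.structure Definition TracialAlgebra (C : numClosedFieldType) :=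
  { X of hasFaithfulTrace C X & StarAlgebra C X }.

Section Star.
Variables (C : numClosedFieldType) (X : starAlgType C).
Implicit Types x y : X.

Lemma starD x y : star (x + y) = star x + star y.
Proof. by have := star_conjlinear 1 x y; rewrite conjC1 !scale1r. Qed.
Lemma star0 : star (0 : X) = 0.
Proof. by apply: (addrI (star 0)); rewrite -starD !addr0. Qed.
Lemma starZ a x : star (a *: x) = a^* *: star x.
Proof. by have := star_conjlinear a x 0; rewrite star0 !addr0. Qed.
Lemma star1 : star (1 : X) = 1.
Proof. by rewrite -[RHS]starK -[X in _ = star X]mulr1 starM starK mulr1. Qed.
Lemma star_sum I (r : seq I) P (F : I -> X) :
  star (\sum_(i <- r | P i) F i) = \sum_(i <- r | P i) star (F i).
Proof. exact: (big_morph _ starD star0). Qed.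
End Star.

(* l^2(X) is X with the following inner product. *)
Definition inner (C : numClosedFieldType) (X : tracialAlgType C) (x y : X) : C :=
  psi (star x * y).

Section Inner.
Variables (C : numClosedFieldType) (X : tracialAlgType C).
Implicit Types x y : X.

HB.instance Definition _ := GRing.isLinear.Build C X C *%R psi (@psi_scalar C X).

Lemma inner_scalar x : scalar (inner x).
Proof. by move=> a y z; rewrite /inner mulrDr -scalerAr linearP. Qed.
HB.instance Definition _ x :=
  GRing.isLinear.Build C X C *%R (inner x) (inner_scalar x).

Lemma innerDr x y y' : inner x (y + y') = inner x y + inner x y'.
Proof. exact: linearD. Qed.
Lemma innerZr a x y : inner x (a *: y) = a * inner x y.
Proof. exact: linearZ. Qed.
Lemma innerDl x x' y : inner (x + x') y = inner x y + inner x' y.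
Proof. by rewrite /inner starD mulrDl linearD. Qed.
Lemma innerZl a x y : inner (a *: x) y = a^* * inner x y.
Proof. by rewrite /inner starZ -scalerAl linearZ. Qed.
Lemma inner0l y : inner 0 y = 0.
Proof. by rewrite /inner star0 mul0r linear0. Qed.
Lemma inner_suml I (r : seq I) P (F : I -> X) y :
  inner (\sum_(i <- r | P i) F i) y = \sum_(i <- r | P i) inner (F i) y.
Proof.
elim/big_rec2: _ => [|i u v _ <-]; first exact: inner0l.
exact: innerDl.
Qed.

Lemma inner_ge0 x : 0 <= inner x x. Proof. exact: psi_ge0. Qed.

Lemma innerC x y : inner y x = (inner x y)^*.
Proof.
have real (z : X) : (inner z z)^* = inner z z.
  by apply/CrealP/ger0_real; apply: inner_ge0.
set a := inner x y; set b := inner y x.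
have h : b^* + a^* = a + b.
  have := real (x + y); rewrite !(innerDl, innerDr) !rmorphD /= !real -/a -/b.
  by rewrite !addrA => /addIr; rewrite -!addrA => /addrI; rewrite addrC.
have k : b^* - a^* = a - b.
  have ii : 'i^* * 'i = 1 :> C by rewrite conjCi mulNr -expr2 sqrCi opprK.
  have := real (x + 'i *: y).
  rewrite !(innerDl, innerDr, innerZl, innerZr) [_ * (_ * inner y y)]mulrA ii.
  rewrite mul1r !rmorphD !rmorphM /= !real -/a -/b conjCK !conjCi.
  rewrite !addrA => /addIr; rewrite -!addrA => /addrI.
  by rewrite !mulNr -!mulrN -!mulrDr => /(mulfI (neq0Ci _)); rewrite addrC.
have : b^* *+ 2 = a *+ 2.
  rewrite !mulr2n; have := congr2 +%R h k; rewrite addrACA subrr addr0 => ->.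
  by rewrite addrACA subrr addr0.
by move/(@pmulrnI C 2 isT) => <-; rewrite conjCK.
Qed.

Lemma inner_eq0 x : (inner x x == 0) = (x == 0).
Proof.
apply/eqP/eqP => [xx0|->]; last exact: inner0l.
suff yx0 (y : X) : inner y x = 0.
  by apply: psi_nondeg => y; rewrite psiC -[y]starK; exact: yx0.
apply/eqP/negPn/negP; set b := inner y x => b0.
have bb0 : b * b^* != 0 by rewrite mulf_neq0 // conjC_eq0.
set t := inner y y + 1.
have tR : t^* = t.
  by apply/CrealP; rewrite rpredD ?rpred1 // ger0_real // inner_ge0.
have bbR : (b * b^*)^* = b * b^* by rewrite rmorphM /= conjCK mulrC.
pose c := - (t / (b * b^*) * b^*).
have cb : c * b = - t.
  by rewrite /c mulNr -(mulrA (t / _)) [b^* * b]mulrC divfK.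
have := inner_ge0 (y + c *: x).
rewrite !(innerDl, innerDr, innerZl, innerZr) xx0 !mulr0 addr0.
rewrite -/b [inner x y](innerC y) -/b -rmorphM cb rmorphN /= tR -addrA.
have aux (u : C) : u + (- (u + 1) - (u + 1)) = - (1 + (u + 1)).
  have e : u - (u + 1) = - 1 by rewrite -opprB [u + 1]addrC addrK.
  by rewrite addrA e [RHS]opprD.
rewrite (aux (inner y y)) -/t.
rewrite oppr_ge0; apply/negP.
rewrite lt_geF // ltr_pwDl ?ltr01 //.
by rewrite /t addr_ge0 ?ler01 // inner_ge0.
Qed.

Lemma inner_nondeg x x' : (forall y, inner y x = inner y x') -> x = x'.
Proof.
move=> h; apply/eqP; rewrite -subr_eq0 -inner_eq0.
by rewrite linearB /= h subrr.
Qed.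

Lemma psi_star x : psi (star x) = (psi x)^*.
Proof. by have := innerC 1 x; rewrite /inner star1 mulr1 mul1r. Qed.
End Inner.

(* Gram matrix of the chosen basis. *)
Definition gram (C : numClosedFieldType) (X : tracialAlgType C) :
  'M[C]_(\dim {:X}) := \matrix_(i, j) inner (bas i) (bas j).

Definition adj_fun (C : numClosedFieldType) (X Y : tracialAlgType C)
    (f : 'Hom(X, Y)) (y : Y) : X :=
  \sum_i (invmx (gram X) *m \col_j inner (f (bas j)) y) i 0 *: bas i.
(* The adjoint of f : l^2(X) -> l^2(Y); see adjP and adj_unique. *)
Definition adj (C : numClosedFieldType) (X Y : tracialAlgType C)
    (f : 'Hom(X, Y)) : 'Hom(Y, X) := linfun (adj_fun f).

Section Adjoint.
Variable C : numClosedFieldType.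

Lemma gram_unit (X : tracialAlgType C) : gram X \in unitmx.
Proof.
rewrite -unitmx_tr -row_free_unit -kermx_eq0; apply/eqP/row_matrixP=> i.
rewrite row0; set r := row i _.
have : r *m (gram X)^T = 0 by apply/sub_kermxP/row_sub.
move=> r0; pose x := \sum_j r 0 j *: bas j : X.
suff x0 : x = 0.
  apply/rowP=> j; rewrite [RHS]mxE -[RHS](linear0 (crd j)) -x0.
  rewrite /x linear_sum (bigD1 j) //= linearZ /= crd_bas eqxx mulr1 big1 ?addr0 //.
  by move=> k kj; rewrite linearZ /= crd_bas eq_sym (negPf kj) mulr0.
apply: inner_nondeg => y; rewrite linear0 (bas_crd y) inner_suml big1 // => k _.
rewrite innerZl linear_sum /= -[RHS](mulr0 (crd k y)^*); congr (_ * _).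
have /rowP/(_ k) := r0; rewrite !mxE => rk; rewrite -[RHS]rk.
by apply: eq_bigr => j _; rewrite linearZ /= !mxE.
Qed.

Section Def.
Variables (X Y : tracialAlgType C) (f : 'Hom(X, Y)).
Fact adj_fun_is_linear : linear (adj_fun f).
Proof.
move=> a y y'; rewrite /adj_fun scaler_sumr -big_split /=; apply: eq_bigr => i _.
rewrite scalerA -scalerDl; congr (_ *: _).
rewrite !mxE mulr_sumr -big_split /=; apply: eq_bigr => j _.
by rewrite !mxE innerDr innerZr mulrDr mulrCA.
Qed.
HB.instance Definition _ := 
  GRing.isLinear.Build C Y X _ (adj_fun f) adj_fun_is_linear.

Lemma adjP x y : inner x (adj f y) = inner (f x) y.
Proof.
rewrite lfunE /= (bas_crd x) (linear_sum f) !inner_suml; apply: eq_bigr => k _.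
rewrite (linearZ_LR f) !innerZl linear_sum /=; congr (_ * _).
have /colP/(_ k) := mulKVmx (gram_unit X) (\col_j inner (f (bas j)) y).
rewrite mxE [RHS]mxE => e; rewrite -[RHS]e; apply: eq_bigr => i _.
by rewrite linearZ /= !mxE mulrC.
Qed.

Lemma adjP' x y : inner (adj f y) x = inner y (f x).
Proof. by rewrite innerC adjP -innerC. Qed.

Lemma adj_unique (g : 'Hom(Y, X)) :
  (forall x y, inner x (g y) = inner (f x) y) -> g = adj f.
Proof.
by move=> h; apply/lfunP=> y; apply: inner_nondeg => x; rewrite h adjP.
Qed.
End Def.

Lemma adjK (X Y : tracialAlgType C) (f : 'Hom(X, Y)) : adj (adj f) = f.
Proof. by symmetry; apply: adj_unique => y x; rewrite adjP'. Qed.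

Lemma adj_comp (X Y Z : tracialAlgType C) (f : 'Hom(Y, Z)) (g : 'Hom(X, Y)) :
  adj (f \o g)%VF = (adj g \o adj f)%VF.
Proof. by symmetry; apply: adj_unique => x z; rewrite !comp_lfunE !adjP. Qed.
End Adjoint.

Section TensorStar.
Variables (C : numClosedFieldType) (X Y : starAlgType C).
Notation XY := (tensor X Y).

Definition tensor_star (M : XY) : XY :=
  \sum_i \sum_j ((M : 'M_(_, _)) i j)^* *: (star (bas i) \ox star (bas j)).

Fact tensor_star_conjlinear a M N :
  tensor_star (a *: M + N) = a^* *: tensor_star M + tensor_star N.
Proof.
rewrite /tensor_star scaler_sumr -big_split /=; apply: eq_bigr => i _.
rewrite scaler_sumr -big_split /=; apply: eq_bigr => j _.
by rewrite !mxE rmorphD rmorphM /= scalerDl scalerA.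
Qed.

Lemma tensor_starE (x : X) (y : Y) : tensor_star (x \ox y) = star x \ox star y.
Proof.
rewrite {2}(bas_crd x) {2}(bas_crd y) !star_sum /tensor_star.
have sl (I : finType) (F : I -> X) (z : Y) :
    (\sum_i F i) \ox z = \sum_i (F i \ox z).
  elim/big_rec2: _ => [|i u v _ <-]; last exact: tensDl.
  by apply/eqP; rewrite tens_eq0 eqxx.
have sr (I : finType) (F : I -> Y) (z : X) :
    z \ox (\sum_i F i) = \sum_i (z \ox F i).
  elim/big_rec2: _ => [|i u v _ <-]; last exact: tensDr.
  by apply/eqP; rewrite tens_eq0 eqxx orbT.
rewrite sl; apply: eq_bigr => i _; rewrite sr; apply: eq_bigr => j _.
by rewrite !starZ tensZl tensZr scalerA mxE rmorphM.
Qed.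

Let sD M N : tensor_star (M + N) = tensor_star M + tensor_star N.
Proof. by have := tensor_star_conjlinear 1 M N; rewrite conjC1 !scale1r. Qed.
Let s0 : tensor_star 0 = 0.
Proof. by apply: (addrI (tensor_star 0)); rewrite -sD !addr0. Qed.

Fact tensor_starM M N : tensor_star (M * N) = tensor_star N * tensor_star M.
Proof.
elim/tens_ind: M => [|M M' IH IH'|x y].
- by rewrite mul0r s0 mulr0.
- by rewrite mulrDl !sD mulrDr IH IH'.
elim/tens_ind: N => [|N N' IH IH'|x' y'].
- by rewrite mulr0 s0 mul0r.
- by rewrite mulrDr !sD mulrDl IH IH'.
by rewrite tensM !tensor_starE !starM tensM.
Qed.

Fact tensor_starK : involutive tensor_star.
Proof.
elim/tens_ind => [|M M' IH IH'|x y].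
- by rewrite !s0.
- by rewrite !sD IH IH'.
by rewrite !tensor_starE !starK.
Qed.

HB.instance Definition _ := isStarAlgebra.Build C XY
  tensor_star_conjlinear tensor_starM tensor_starK.

Lemma star_tens (x : X) (y : Y) : star (x \ox y) = star x \ox star y.
Proof. exact: tensor_starE. Qed.
End TensorStar.

(* A basis of X that is orthogonal in l^2(X). *)
Lemma orthogonal_basis (C : numClosedFieldType) (X : tracialAlgType C) :
  exists e : 'I_(\dim {:X}) -> X,
    (forall i j, i != j -> inner (e i) (e j) = 0) /\
    (forall x, exists c : 'I_(\dim {:X}) -> C, x = \sum_i c i *: e i).
Proof.
have herm : gram X \is hermsymmx.
  apply/is_hermitianmxP; rewrite expr0 scale1r; apply/matrixP => i j.
  by rewrite !mxE innerC.
have /orthomx_spectralP := hermitian_normalmx herm.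
set P := spectralmx _; set D := diag_mx _ => GE.
have Pu : P \is unitarymx by exact: spectral_unitarymx.
have PU : P \in unitmx := unitarymx_unit Pu.
rewrite -/P -/D in GE.
have DE : P *m gram X *m invmx P = D by rewrite GE !mulmxA mulmxV // mul1mx mulmxK.
exists (fun i => \sum_k (P i k)^* *: bas k); split=> [i j ij|x].
  have /matrixP/(_ i j) := DE; rewrite [RHS]mxE (negPf ij) mulr0n => <-.
  rewrite inner_suml invmx_unitary // -mulmxA mxE; apply: eq_bigr => k _.
  rewrite innerZl conjCK; congr (_ * _); rewrite linear_sum mxE /=.
  by apply: eq_bigr => l _; rewrite innerZr !mxE mulrC.
pose Q := map_mx Num.conj P; pose c := (\row_k crd k x) *m invmx Q.
have QU : Q \in unitmx by rewrite map_unitmx.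
have cQ : c *m Q = \row_k crd k x by rewrite mulmxKV.
exists (fun i => c 0 i); rewrite {1}(bas_crd x).
under [RHS]eq_bigr do rewrite scaler_sumr.
rewrite exchange_big /=; apply: eq_bigr => k _.
have /rowP/(_ k) := cQ; rewrite mxE [RHS]mxE => ck; rewrite -ck scaler_suml.
by apply: eq_bigr => i _; rewrite scalerA [Q i k]mxE.
Qed.

Section TensorTrace.
Variables (C : numClosedFieldType) (X Y : tracialAlgType C).
Notation XY := (tensor X Y).

Definition tensor_psi (M : XY) : C :=
  (tlift (fun x y => psi x * psi y : C^o) : XY -> C^o) M.

Lemma tensor_psiE (x : X) (y : Y) : tensor_psi (x \ox y) = psi x * psi y.
Proof.
rewrite /tensor_psi tliftE // => [z a u v|z a u v].
  by rewrite linearP mulrDl -mulrA.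
by rewrite linearP mulrDr mulrCA.
Qed.

Fact tensor_psi_scalar : scalar tensor_psi.
Proof. by move=> a M N; rewrite /tensor_psi linearP. Qed.

Let pD M N : tensor_psi (M + N) = tensor_psi M + tensor_psi N.
Proof. by have := tensor_psi_scalar 1 M N; rewrite scale1r mul1r. Qed.
Let p0 : tensor_psi 0 = 0.
Proof. by apply: (addrI (tensor_psi 0)); rewrite -pD !addr0. Qed.
Let psum I (r : seq I) P (F : I -> XY) :
  tensor_psi (\sum_(i <- r | P i) F i) = \sum_(i <- r | P i) tensor_psi (F i).
Proof. by elim/big_rec2: _ => [|i u v _ <-]. Qed.

Fact tensor_psiC M N : tensor_psi (M * N) = tensor_psi (N * M).
Proof.
elim/tens_ind: M => [|M M' IH IH'|x y].
- by rewrite mul0r mulr0.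
- by rewrite mulrDl mulrDr !pD IH IH'.
elim/tens_ind: N => [|N N' IH IH'|x' y'].
- by rewrite mul0r mulr0.
- by rewrite mulrDl mulrDr !pD IH IH'.
by rewrite !tensM !tensor_psiE psiC [in X in _ * X]psiC.
Qed.

Lemma orthogonal_decomp (e : 'I_(\dim {:X}) -> X) :
  (forall x, exists c : 'I_(\dim {:X}) -> C, x = \sum_i c i *: e i) ->
  forall M : XY, exists y : 'I_(\dim {:X}) -> Y, M = \sum_i e i \ox y i.
Proof.
move=> es; elim/tens_ind => [|M M' [y ->] [y' ->]|x y].
- exists (fun=> 0); rewrite big1 // => i _.
  by apply/eqP; rewrite tens_eq0 eqxx orbT.
- exists (fun i => y i + y' i); rewrite -big_split; apply: eq_bigr => i _.
  by rewrite tensDr.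
- have [c ->] := es x; exists (fun i => c i *: y).
  elim/big_rec2: _ => [|i u v _ <-].
    by apply/eqP; rewrite tens_eq0 eqxx.
  by rewrite tensDl tensZl tensZr.
Qed.

Fact tensor_psi_ge0 M : 0 <= tensor_psi (star M * M).
Proof.
have [e [eo es]] := orthogonal_basis X.
have [y ->] := orthogonal_decomp es M.
rewrite star_sum mulr_suml psum sumr_ge0 // => i _.
rewrite mulr_sumr psum (bigD1 i) //= big1 ?addr0 => [|j ji].
  by rewrite star_tens tensM tensor_psiE mulr_ge0 ?psi_ge0.
rewrite star_tens tensM tensor_psiE.
have := eo i j; rewrite eq_sym => /(_ ji); rewrite /inner => ->.
by rewrite mul0r.
Qed.

Fact tensor_psi_nondeg M : (forall N, tensor_psi (M * N) = 0) -> M = 0.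
Proof.
have [e [eo es]] := orthogonal_basis X.
have [y ->] := orthogonal_decomp es M => h.
rewrite big1 // => i _; apply/eqP; rewrite tens_eq0 -inner_eq0.
have [//|/= d0] := eqVneq (inner (e i) (e i)) 0.
apply/eqP/psi_nondeg => z; apply: (mulfI d0); rewrite mulr0 psiC.
rewrite -(h (star (e i) \ox z)) tensor_psiC mulr_sumr psum (bigD1 i) //=.
rewrite tensM tensor_psiE -/(inner _ _) big1 ?addr0 // => j ji.
rewrite tensM tensor_psiE.
have := eo i j; rewrite eq_sym => /(_ ji); rewrite /inner => ->.
by rewrite mul0r.
Qed.

HB.instance Definition _ := hasFaithfulTrace.Build C XY
  tensor_psi_scalar tensor_psi_ge0 tensor_psi_nondeg tensor_psiC.

Lemma psi_tens (x : X) (y : Y) : psi (x \ox y) = psi x * psi y.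
Proof. exact: tensor_psiE. Qed.

Lemma inner_tens (x x' : X) (y y' : Y) :
  inner (x \ox y) (x' \ox y') = inner x x' * inner y y'.
Proof. by rewrite /inner star_tens tensM psi_tens. Qed.
End TensorTrace.

Section Multiplication.
Variables (C : numClosedFieldType) (X : tracialAlgType C).

(* The multiplication as a linear map m : l^2(X) (x) l^2(X) -> l^2(X). *)
Definition mul_lfun : 'Hom(tensor X X, X) := linfun (tlift (fun x y : X => x * y)).

Lemma mul_lfunE (x y : X) : mul_lfun (x \ox y) = x * y.
Proof.
rewrite lfunE /= tliftE // => [z a u v|z a u v].
  by rewrite mulrDl scalerAl.
by rewrite mulrDr scalerAr.
Qed.
End Multiplication.
Arguments mul_lfun {C X}.

HB.mixin Record isFinQSpace (C : numClosedFieldType) X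
    of TracialAlgebra C X := {
  mul_lfun_adjK : (mul_lfun \o adj mul_lfun = \1 :> 'End(X))%VF
}.
#[short(type="finQSpaceType")]
HB.structure Definition FinQSpace (C : numClosedFieldType) :=
  { X of isFinQSpace C X & TracialAlgebra C X }.

Section TensorQSpace.
Variable C : numClosedFieldType.

Lemma inner_ext_tens (U V : tracialAlgType C) (M N : tensor U V) :
  (forall u v, inner (u \ox v) M = inner (u \ox v) N) -> M = N.
Proof.
move=> h; apply: inner_nondeg; elim/tens_ind => [|P P' IH IH'|//].
  by rewrite !inner0l.
by rewrite !innerDl IH IH'.
Qed.

Lemma adj_unique_tens (U V : tracialAlgType C) (Y : tracialAlgType C)
    (f : 'Hom(tensor U V, Y)) (g : 'Hom(Y, tensor U V)) :
  (forall u v y, inner (u \ox v) (g y) = inner (f (u \ox v)) y) -> g = adj f.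
Proof.
by move=> h; apply/lfunP => y; apply: inner_ext_tens => u v; rewrite h adjP.
Qed.

Lemma adj_tensf (U V U' V' : tracialAlgType C)
    (f : 'Hom(U, U')) (g : 'Hom(V, V')) :
  adj (f \ox g)%VF = (adj f \ox adj g)%VF.
Proof.
symmetry; apply: adj_unique_tens => u v; rewrite tensfE.
elim/tens_ind => [|M N IM IN|u' v'].
- by rewrite !linear0.
- by rewrite !linearD /= IM IN.
by rewrite tensfE !inner_tens !adjP.
Qed.

Lemma tensf_comp (U V U' V' U'' V'' : vectType C) (f : 'Hom(U', U''))
    (g : 'Hom(V', V'')) (f' : 'Hom(U, U')) (g' : 'Hom(V, V')) :
  ((f \ox g) \o (f' \ox g') = (f \o f') \ox (g \o g'))%VF.
Proof.
by apply: eq_tens_lfun => u v; rewrite comp_lfunE !tensfE !comp_lfunE.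
Qed.

Lemma tensf1 (U V : vectType C) :
  ((\1 : 'End(U)) \ox (\1 : 'End(V)) = \1)%VF.
Proof. by apply: eq_tens_lfun => u v; rewrite tensfE !id_lfunE. Qed.

Lemma eq_tens2_lfun (U V W Z T : vectType C)
    (f g : 'Hom(tensor (tensor U V) (tensor W Z), T)) :
  (forall u v w z, f ((u \ox v) \ox (w \ox z)) = g ((u \ox v) \ox (w \ox z))) ->
  f = g.
Proof.
move=> h; apply: eq_tens_lfun => p q.
elim/tens_ind: p => [|p p' IH IH'|u v].
- by rewrite (_ : 0 \ox q = 0) ?linear0 //; apply/eqP; rewrite tens_eq0 eqxx.
- by rewrite tensDl !linearD /= IH IH'.
elim/tens_ind: q => [|q q' IH IH'|w z] //.
- by rewrite (_ : _ \ox 0 = 0) ?linear0 //; apply/eqP; rewrite tens_eq0 eqxx orbT.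
- by rewrite tensDr !linearD /= IH IH'.
Qed.

Lemma midswapK (U V W Z : vectType C) :
  (midswap U W V Z \o midswap U V W Z = \1)%VF.
Proof.
by apply: eq_tens2_lfun => u v w z; rewrite comp_lfunE !midswapE id_lfunE.
Qed.

Lemma adj_midswap (U V W Z : tracialAlgType C) :
  adj (midswap U V W Z) = midswap U W V Z.
Proof.
symmetry; apply: adj_unique_tens => p q r.
elim/tens_ind: p => [|p p' IH IH'|u v].
- by rewrite (_ : 0 \ox q = 0) ?linear0 ?inner0l //; apply/eqP; rewrite tens_eq0 eqxx.
- by rewrite tensDl linearD !innerDl IH IH'.
elim/tens_ind: q => [|q q' IH IH'|w z].
- by rewrite (_ : _ \ox 0 = 0) ?linear0 ?inner0l //; apply/eqP; rewrite tens_eq0 eqxx orbT.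
- by rewrite tensDr linearD !innerDl IH IH'.
elim/tens_ind: r => [|r r' IH IH'|a b].
- by rewrite !linear0.
- by rewrite !linearD /= IH IH'.
elim/tens_ind: a => [|p p' IH IH'|a1 a2].
- by rewrite (_ : 0 \ox b = 0) ?linear0 //; apply/eqP; rewrite tens_eq0 eqxx.
- by rewrite tensDl !linearD /= IH IH'.
elim/tens_ind: b => [|p p' IH IH'|b1 b2].
- by rewrite (_ : _ \ox 0 = 0) ?linear0 //; apply/eqP; rewrite tens_eq0 eqxx orbT.
- by rewrite tensDr !linearD /= IH IH'.
by rewrite !midswapE !inner_tens mulrACA.
Qed.

Lemma mul_lfun_tens (X Y : tracialAlgType C) :
  (mul_lfun : 'Hom(tensor (tensor X Y) (tensor X Y), tensor X Y)) =
  ((mul_lfun \ox mul_lfun) \o midswap X Y X Y)%VF.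
Proof.
apply: eq_tens2_lfun => x y x' y'.
by rewrite comp_lfunE midswapE tensfE !mul_lfunE tensM.
Qed.

Fact tensor_mul_lfun_adjK (X Y : finQSpaceType C) :
  (mul_lfun \o adj mul_lfun = \1 :> 'End(tensor X Y))%VF.
Proof.
rewrite mul_lfun_tens adj_comp adj_midswap adj_tensf comp_lfunA.
rewrite -(comp_lfunA (mul_lfun \ox mul_lfun)%VF) midswapK comp_lfun1r tensf_comp.
by rewrite !mul_lfun_adjK tensf1.
Qed.

(* The finite quantum space X x Y. *)
HB.instance Definition _ (X Y : finQSpaceType C) :=
  isFinQSpace.Build C (tensor X Y) (tensor_mul_lfun_adjK X Y).
End TensorQSpace.

Section QuantumGraphs.
Variables (C : numClosedFieldType) (X : finQSpaceType C).
Implicit Types A B : 'End(X).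

Definition eta : X := 1.
(* The adjoint of the map 1 |-> eta. *)
Definition eta_dag (x : X) : C := inner eta x.

Lemma eta_dagE x : eta_dag x = psi x.
Proof. by rewrite /eta_dag /inner star1 mul1r. Qed.

Definition etaeta_dag_fun (x : X) : X := eta_dag x *: eta.
Fact etaeta_dag_fun_is_linear : linear etaeta_dag_fun.
Proof.
move=> a x y.
by rewrite /etaeta_dag_fun /eta_dag innerDr innerZr scalerDl scalerA.
Qed.
HB.instance Definition _ :=
  GRing.isLinear.Build C X X _ etaeta_dag_fun etaeta_dag_fun_is_linear.

Definition opI : 'End(X) := \1%VF.
Definition opJ : 'End(X) := linfun etaeta_dag_fun.

Lemma opJE x : opJ x = eta_dag x *: eta. Proof. by rewrite lfunE. Qed.

Definition schur A B : 'End(X) := (mul_lfun \o (A \ox B) \o adj mul_lfun)%VF.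

(* The operation A |-> A^*, as opposed to the adjoint. *)
Definition op_conj_fun A (x : X) : X := star (A (star x)).
Fact op_conj_fun_is_linear A : linear (op_conj_fun A).
Proof.
move=> a x y.
by rewrite /op_conj_fun star_conjlinear linearP star_conjlinear conjCK.
Qed.
HB.instance Definition _ A :=
  GRing.isLinear.Build C X X _ (op_conj_fun A) (op_conj_fun_is_linear A).
Definition op_conj A : 'End(X) := linfun (op_conj_fun A).

Lemma op_conjE A x : op_conj A x = star (A (star x)).
Proof. by rewrite lfunE. Qed.

Record simple_quantum_graph A : Prop := SimpleQuantumGraph {
  sqg_schur : schur A A = A;
  sqg_real : op_conj A = A;
  sqg_selfadj : adj A = A;
  sqg_loopless_r : schur A opI = 0;
  sqg_loopless_l : schur opI A = 0
}.

Record strongly_regular_quantum_graph A (n k lambda mu : C) : Prop :=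
  StronglyRegularQuantumGraph {
  srqg_simple : simple_quantum_graph A;
  srqg_order : eta_dag eta = n;
  srqg_square :
    (A \o A)%VF = k *: opI + lambda *: A + mu *: (opJ - opI - A)
}.

(* In qls_counit, the identity eta^dag L = eta^dag (x) eta^dag is evaluated on
   pure tensors. *)
Record quantum_latin_square (L : 'Hom(tensor X X, X)) : Prop :=
  QuantumLatinSquare {
  qls_star : forall x y : X, L (star x \ox star y) = star (L (x \ox y));
  qls_comul : (adj mul_lfun \o L =
    (L \ox L) \o midswap X X X X \o (adj mul_lfun \ox adj mul_lfun))%VF;
  qls_counit : forall x y : X, eta_dag (L (x \ox y)) = eta_dag x * eta_dag y;
  qls_eta_l : forall x : X, L (eta \ox x) = eta_dag x *: eta;
  qls_eta_r : forall x : X, L (x \ox eta) = eta_dag x *: eta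
}.
End QuantumGraphs.
Arguments simple_quantum_graph {C} X A.
Arguments strongly_regular_quantum_graph {C} X A n k lambda mu.
Arguments quantum_latin_square {C} X L.
Arguments eta {C X}.
Arguments eta_dag {C X}.
Arguments opI {C X}.
Arguments opJ {C X}.

Lemma spanning_neq0 (C : fieldType) (X : vectType C)
    (e : 'I_(\dim {:X}) -> X) :
  (forall x, exists c : 'I_(\dim {:X}) -> C, x = \sum_i c i *: e i) ->
  forall i, e i != 0.
Proof.
move=> es i; set t := [tuple e j | j < \dim {:X}].
have st : (fullv <= <<t>>)%VS.
  apply/subvP => x _; have [c ->] := es x; apply: memv_suml => j _.
  by apply/memvZ/memv_span/mapP; exists j; rewrite ?mem_enum.
have ft : free t.
  by rewrite /free eqn_leq dim_span size_tuple /= dimvS.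
by apply: (free_not0 ft); apply/mapP; exists i; rewrite ?mem_enum.
Qed.

Lemma eta_dag_eta (C : numClosedFieldType) (X : finQSpaceType C) :
  eta_dag (eta : X) = (\dim {:X})%:R.
Proof.
have [e [eo es]] := orthogonal_basis X.
have d0 i : inner (e i) (e i) != 0 by rewrite inner_eq0 spanning_neq0.
have expand a : a = \sum_i ((inner (e i) (e i))^-1 * inner (e i) a) *: e i.
  have [c ac] := es a; rewrite {1}ac; apply: eq_bigr => i _.
  have -> : inner (e i) a = c i * inner (e i) (e i).
    rewrite {1}ac linear_sum (bigD1 i) //= innerZr big1 ?addr0 // => j ji.
    by rewrite innerZr eo ?mulr0 // eq_sym.
  by rewrite mulrC mulfK.
pose M : tensor X X := \sum_i (inner (e i) (e i))^-1 *: (e i \ox star (e i)).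
have ME : adj mul_lfun (1 : X) = M.
  apply: inner_ext_tens => a b; rewrite adjP mul_lfunE.
  rewrite /inner mulr1 starM {1}(expand a) star_sum mulr_sumr linear_sum.
  rewrite /M mulr_sumr linear_sum; apply: eq_bigr => i _ /=.
  rewrite starZ -!scalerAr !linearZ /= star_tens tensM psi_tens rmorphM fmorphV /=.
  by rewrite -!innerC mulrA.
have := congr1 (fun f : 'End(X) => psi (f 1)) (@mul_lfun_adjK C X).
rewrite comp_lfunE id_lfunE ME /M linear_sum linear_sum /= eta_dagE => <-.
rewrite -[\dim _ in RHS]card_ord -sumr_const; apply: eq_bigr => i _.
by rewrite linearZ /= mul_lfunE linearZ /= psiC mulVf.
Qed.

(* Main.v *)
From HB Require Import structures.
Require Import Defs.
From mathcomp Require Import all_boot all_order all_algebra all_field.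
From mathcomp Require Import reals complex ring.
Set Implicit Arguments.
Unset Strict Implicit.
Unset Printing Implicit Defensive.

Import GRing.Theory Num.Theory.
Local Open Scope ring_scope.

(** A Latin square of order n is an orthogonal array with three columns: on the
    n^2 cells, the row, the column and the symbol are three maps onto an n-point
    set, and any two of them together determine the cell.  Joining two cells
    when they are distinct and agree in some column gives the Latin square graph, and the proof
    below is the quantum version of this counting argument.

    A map of quantum spaces Y -> X is a unital *-homomorphism
    f : C(X) -> C(Y), and f f^dag is then the operator of the relation
    of having the same value under the map.  The three summands I (x) J, J (x) I and
    L^dag L are of this form, for f(x) = x (x) 1, f(x) = 1 (x) x and
    f = L^dag: [qls_star] and [qls_comul] say that L^dag is *-preserving and
    multiplicative, [qls_counit] that it is unital ([qls_adj_star_hom]).  That two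
    such maps f, g together determine a point of Y = X x X is expressed by
    independence, psi (f a * g b) = psi a * psi b; for L^dag and the coordinates
    this is [qls_eta_l] and [qls_eta_r].

    Write S_f := f f^dag.  Everything follows from two multiplication tables.
    For the Schur product: S_f . S_f = S_f, since f commutes with m and
    m m^dag = 1 ([schur_star_hom]); S_f . S_g = I for independent f, g
    ([schur_independent]), because S_f . S_g = H H^dag with H = m (f (x) g),
    which is an isometry between spaces of equal dimension and hence unitary;
    and S_f . I = I = I . S_f ([schur_star_homI], [schurI_star_hom]).
    For composition: f^dag f = n I and f^dag g = J, so that S_f S_f = n S_f and
    S_f S_g = J.  Expanding A . A, A . I and A A for A = sum_f S_f - k I is then
    pure algebra, for any number k of pairwise independent maps
    ([orthogonal_array_srg]); the theorem is the case k = 3. *)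

(** * Squares of sums for bilinear operations *)

Lemma linear_fun_sum (K : fieldType) (U V : lmodType K) (f : U -> V)
    (I : finType) (P : pred I) (F : I -> U) :
  linear f -> f (\sum_(i | P i) F i) = \sum_(i | P i) f (F i).
Proof.
move=> lf; pose g : {linear U -> V} := HB.pack f (GRing.isLinear.Build K U V _ f lf).
exact: (linear_sum g).
Qed.

(** Used twice, for the Schur product and for composition of the operators S_f:
    the k diagonal terms reproduce the sum, and the k (k - 1) ordered pairs of
    distinct indices all contribute the same vector. *)
Lemma square_sum (K : fieldType) (V : lmodType K) (op : V -> V -> V)
    (k : nat) (S : 'I_k -> V) (a : K) (B : V) :
  (forall y, linear (op^~ y)) -> (forall x, linear (op x)) ->
  (forall i, op (S i) (S i) = a *: S i) ->
  (forall i j, i != j -> op (S i) (S j) = B) ->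
  op (\sum_i S i) (\sum_i S i) =
    a *: (\sum_i S i) + (k%:R * (k%:R - 1)) *: B.
Proof.
move=> opl opr Sii Sij; rewrite (linear_fun_sum _ _ (opl _)) scaler_sumr.
transitivity (\sum_(i < k) (a *: S i + (k%:R - 1) *: B)).
  apply: eq_bigr => i _; rewrite (linear_fun_sum _ _ (opr _)) (bigD1 i) //= Sii.
  congr (_ + _); transitivity (\sum_(j < k | j != i) B).
    by apply: eq_bigr => j ji; rewrite Sij // eq_sym.
  rewrite sumr_const -[X in B *+ X]/(#|predC1 i|) cardC1 card_ord -scaler_nat.
  by rewrite -subn1 natrB // (leq_trans _ (ltn_ord i)).
by rewrite big_split /= sumr_const card_ord -scaler_nat scalerA.
Qed.

(** * The Schur product *)

Section Schur.
Variables (C : numClosedFieldType) (Y : finQSpaceType C).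
Implicit Types A B : 'End(Y).

Lemma schur_linearl B : linear (fun A => schur A B).
Proof.
move=> a A A'; rewrite /schur comp_lfunZl comp_lfunZr -comp_lfunDl -comp_lfunDr.
congr (_ \o _ \o _)%VF; apply: eq_tens_lfun => x y.
by rewrite add_lfunE scale_lfunE !tensfE add_lfunE scale_lfunE tensDl tensZl.
Qed.

Lemma schur_linearr A : linear (schur A).
Proof.
move=> a B B'; rewrite /schur comp_lfunZl comp_lfunZr -comp_lfunDl -comp_lfunDr.
congr (_ \o _ \o _)%VF; apply: eq_tens_lfun => x y.
by rewrite add_lfunE scale_lfunE !tensfE add_lfunE scale_lfunE tensDr tensZr.
Qed.

Lemma schurII : schur opI opI = opI :> 'End(Y).
Proof. by rewrite /schur /opI tensf1 comp_lfun1r mul_lfun_adjK. Qed.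

(** The Schur product of two positive operators is positive; the explicit factor
    m (f (x) g) is what makes Schur products of such operators computable. *)
Lemma schur_adj (X X' : tracialAlgType C) (f : 'Hom(X, Y)) (g : 'Hom(X', Y)) :
  schur (f \o adj f)%VF (g \o adj g)%VF =
  ((mul_lfun \o (f \ox g)) \o adj (mul_lfun \o (f \ox g)))%VF.
Proof. by rewrite /schur adj_comp adj_tensf -tensf_comp !comp_lfunA. Qed.
End Schur.

(** * Isometries and adjoints *)

Lemma isometry_unitary (C : numClosedFieldType) (U V : tracialAlgType C)
    (f : 'Hom(U, V)) :
  \dim {:U} = \dim {:V} -> (adj f \o f = \1)%VF -> (f \o adj f = \1)%VF.
Proof.
move=> dUV fK.
have ker0 : lker f == 0%VS.
  apply/lker0P => x y fxy.
  by rewrite -[x]id_lfunE -[y]id_lfunE -fK !comp_lfunE fxy.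
have img : (f @: fullv)%VS = fullv.
  by apply/eqP; rewrite eqEdim subvf limg_dim_eq ?dUV ?leqnn // (eqP ker0) capv0.
apply/lfunP => y; have := memvf y; rewrite -img => /memv_imgP[x _ ->].
by rewrite comp_lfunE -(comp_lfunE (adj f)) fK !id_lfunE.
Qed.

Lemma adj1 (C : numClosedFieldType) (X : tracialAlgType C) :
  adj (\1 : 'End(X))%VF = \1%VF.
Proof. by symmetry; apply: adj_unique => x y; rewrite !id_lfunE. Qed.

(** Both sides pair with x to the conjugate of psi (f x * y), by traciality. *)
Lemma adj_star (C : numClosedFieldType) (X Y : tracialAlgType C) (f : 'Hom(X, Y)) :
  (forall x, f (star x) = star (f x)) ->
  forall y, adj f (star y) = star (adj f y).
Proof.
move=> f_star y; apply: inner_nondeg => x.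
rewrite adjP /inner -!starM !psi_star.
have := adjP f (star x) y; rewrite /inner f_star !starK => e.
by rewrite [X in _ = X^*]psiC e psiC.
Qed.

(** * Unital star-homomorphisms and their fibre relations *)

Record star_hom (C : numClosedFieldType) (X Y : starAlgType C)
    (f : 'Hom(X, Y)) : Prop := StarHom {
  star_hom1 : f 1 = 1;
  star_homM : forall x y, f (x * y) = f x * f y;
  star_hom_star : forall x, f (star x) = star (f x)
}.

Section StarHom.
Variables (C : numClosedFieldType) (X Y : finQSpaceType C).
Variable f : 'Hom(X, Y).
Hypothesis fh : star_hom f.

Lemma inner_star_hom (a b : X) : inner (f a) (f b) = psi (f (star a * b)).
Proof. by rewrite /inner star_homM // star_hom_star. Qed.

Lemma op_conj_star_hom : op_conj (f \o adj f)%VF = (f \o adj f)%VF.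
Proof.
apply/lfunP => y.
by rewrite op_conjE !comp_lfunE (adj_star (star_hom_star fh)) star_hom_star // starK.
Qed.

Lemma schur_star_hom : schur (f \o adj f)%VF (f \o adj f)%VF = (f \o adj f)%VF.
Proof.
rewrite schur_adj.
have -> : (mul_lfun \o (f \ox f) = f \o mul_lfun)%VF.
  by apply: eq_tens_lfun => x y; rewrite !comp_lfunE tensfE !mul_lfunE star_homM.
by rewrite adj_comp comp_lfunA -(comp_lfunA f) mul_lfun_adjK comp_lfun1r.
Qed.

(** Classically, every point has the same value as itself.  By [schur_adj] the product is K K^dag with K = m (f (x) 1).
    Frobenius reciprocity gives K^dag y = (1 (x) h) (m^dag 1) with
    h x = f x * y, and K (1 (x) h) = h m because f is multiplicative, so
    K K^dag y = h (m m^dag 1) = h 1 = y. *)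
Lemma schur_star_homI : schur (f \o adj f)%VF opI = opI.
Proof.
have -> : opI = (\1 \o adj \1)%VF :> 'End(Y) by rewrite adj1 comp_lfun1l.
rewrite schur_adj adj1 comp_lfun1l; apply/lfunP => y; rewrite id_lfunE comp_lfunE.
have [h hE] : exists h : 'Hom(X, Y), forall x, h x = f x * y.
  by exists (amulr y \o f)%VF => x; rewrite comp_lfunE lfunE.
have -> : adj (mul_lfun \o (f \ox \1))%VF y = (\1 \ox h)%VF (adj mul_lfun 1).
  apply: inner_ext_tens => x z.
  rewrite adjP comp_lfunE tensfE mul_lfunE id_lfunE.
  rewrite -[(\1 \ox h)%VF]adjK adjP adj_tensf tensfE adj1 adjP id_lfunE mul_lfunE.
  by rewrite /inner mulr1 !starM -star_hom_star // -mulrA -hE -/(inner z _) -adjP'.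
rewrite -comp_lfunE -comp_lfunA tensf_comp comp_lfun1l comp_lfun1r.
have -> : (mul_lfun \o (f \ox h) = h \o mul_lfun)%VF.
  by apply: eq_tens_lfun => a b; rewrite !comp_lfunE tensfE !mul_lfunE !hE star_homM // mulrA.
by rewrite -comp_lfunE -comp_lfunA mul_lfun_adjK comp_lfun1r hE star_hom1 // mul1r.
Qed.

(** The mirror image of [schur_star_homI], with h x = y * f x; traciality of psi
    moves the factor to the other side. *)
Lemma schurI_star_hom : schur opI (f \o adj f)%VF = opI.
Proof.
have -> : opI = (\1 \o adj \1)%VF :> 'End(Y) by rewrite adj1 comp_lfun1l.
rewrite schur_adj adj1 comp_lfun1l; apply/lfunP => y; rewrite id_lfunE comp_lfunE.
have [h hE] : exists h : 'Hom(X, Y), forall x, h x = y * f x.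
  by exists (amull y \o f)%VF => x; rewrite comp_lfunE lfunE.
have -> : adj (mul_lfun \o (\1 \ox f))%VF y = (h \ox \1)%VF (adj mul_lfun 1).
  apply: inner_ext_tens => z x.
  rewrite adjP comp_lfunE tensfE mul_lfunE id_lfunE.
  rewrite -[(h \ox \1)%VF]adjK adjP adj_tensf tensfE adj1 adjP id_lfunE mul_lfunE.
  rewrite /inner mulr1 !starM [RHS]psiC -[RHS]/(inner _ _) adjP' hE.
  by rewrite /inner -mulrA psiC star_hom_star // mulrA.
rewrite -comp_lfunE -comp_lfunA tensf_comp comp_lfun1l comp_lfun1r.
have -> : (mul_lfun \o (h \ox f) = h \o mul_lfun)%VF.
  by apply: eq_tens_lfun => a b; rewrite !comp_lfunE tensfE !mul_lfunE !hE star_homM // mulrA.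
by rewrite -comp_lfunE -comp_lfunA mul_lfun_adjK comp_lfun1r hE star_hom1 // mulr1.
Qed.
End StarHom.

(** * Independent maps and orthogonal arrays *)

Section OrthogonalArray.
Variables (C : numClosedFieldType) (X Y : finQSpaceType C).

Implicit Types (f g : 'Hom(X, Y)) (a b : X).

(** Stochastic independence of the subalgebras f(X) and g(X), up to the
    normalisation of psi.  Classically, for maps F, G from n^2 points to n points,
    it says that each pair of values is taken exactly once. *)
Definition independent (f g : 'Hom(X, Y)) :=
  forall a b, psi (f a * g b) = psi a * psi b.

Lemma independentC f g : independent f g -> independent g f.
Proof. by move=> fg a b; rewrite psiC fg mulrC. Qed.

Lemma independent_psi f g a : star_hom g -> independent f g ->
  psi (f a) = eta_dag (eta : X) * psi a.
Proof. by move=> gh fg; rewrite -[f a]mulr1 -(star_hom1 gh) fg eta_dagE mulrC. Qed.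

Lemma independent_inner f g a b : star_hom f -> independent f g ->
  inner (f a) (g b) = (psi a)^* * psi b.
Proof. by move=> fh fg; rewrite /inner -star_hom_star // fg psi_star. Qed.

Lemma star_hom_adj_comp f c : star_hom f -> (forall a, psi (f a) = c * psi a) ->
  (adj f \o f)%VF = c *: opI.
Proof.
move=> fh fc; apply/lfunP => a; apply: inner_nondeg => b.
rewrite comp_lfunE adjP inner_star_hom // fc.
by rewrite scale_lfunE id_lfunE innerZr.
Qed.

Lemma independent_adj_comp f g : star_hom f -> independent f g ->
  (adj f \o g)%VF = opJ.
Proof.
move=> fh fg; apply/lfunP => b; apply: inner_nondeg => a.
rewrite comp_lfunE adjP independent_inner // opJE innerZr eta_dagE mulrC.
by rewrite /inner mulr1 psi_star.
Qed.

Lemma star_hom_opJ f g : star_hom f -> star_hom g ->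
  (f \o opJ \o adj g)%VF = opJ.
Proof.
move=> fh gh; apply/lfunP => y; rewrite !comp_lfunE !opJE linearZ /= star_hom1 //.
by rewrite /eta_dag adjP star_hom1.
Qed.

(** The product is H H^dag with H = m (f (x) g).  Independence makes H an isometry:
    by traciality <H (a (x) b), H (c (x) d)> =
    psi (f (star a * c) * g (d * star b)), which factors as <a, c> <b, d>.  The dimension hypothesis turns it into a unitary:
    classically, f and g together separate the points. *)
Lemma schur_independent f g : \dim {:Y} = \dim {:tensor X X} ->
  star_hom f -> star_hom g -> independent f g ->
  schur (f \o adj f)%VF (g \o adj g)%VF = opI.
Proof.
move=> dY fh gh fg; rewrite schur_adj; apply: isometry_unitary => //.
apply: eq_tens_lfun => a b; apply: inner_ext_tens => c d.
rewrite comp_lfunE adjP id_lfunE !comp_lfunE !tensfE !mul_lfunE inner_tens.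
rewrite /inner starM -!star_hom_star // mulrA -(mulrA (g _)) -star_homM //.
by rewrite psiC mulrA -star_homM // psiC fg [psi (b * _)]psiC.
Qed.

(** The Latin square type graph L_k(n) of an orthogonal array with k columns, over
    an arbitrary quantum space Y with n^2 points.  Classically, the hypothesis
    on psi (phi i a) says that column i takes each of its n values n times. *)
Theorem orthogonal_array_srg k (phi : 'I_k -> 'Hom(X, Y)) (n := eta_dag (eta : X)) :
  \dim {:Y} = \dim {:tensor X X} ->
  (forall i, star_hom (phi i)) ->
  (forall i a, psi (phi i a) = n * psi a) ->
  (forall i j, i != j -> independent (phi i) (phi j)) ->
  strongly_regular_quantum_graph Y
    (\sum_i (phi i \o adj (phi i))%VF - k%:R *: opI)
    (n ^+ 2) (k%:R * (n - 1)) (n - 2 + (k%:R - 1) * (k%:R - 2)) (k%:R * (k%:R - 1)).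
Proof.
move=> dY ph pn pi; set T : 'End(Y) := \sum_i _.
have schurTT : schur T T = T + (k%:R * (k%:R - 1)) *: opI.
  rewrite -[X in X + _]scale1r.
  apply: (square_sum (@schur_linearl C Y) (@schur_linearr C Y)) => [i|i j ij].
    by rewrite schur_star_hom // scale1r.
  by rewrite schur_independent //; apply: pi.
have schurTI : schur T opI = k%:R *: opI.
  rewrite (linear_fun_sum _ _ (@schur_linearl C Y opI)).
  under eq_bigr do rewrite schur_star_homI //.
  by rewrite sumr_const card_ord -scaler_nat.
have schurIT : schur opI T = k%:R *: opI.
  rewrite (linear_fun_sum _ _ (@schur_linearr C Y opI)).
  under eq_bigr do rewrite schurI_star_hom //.
  by rewrite sumr_const card_ord -scaler_nat.
have compTT : (T \o T)%VF = n *: T + (k%:R * (k%:R - 1)) *: opJ.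
  apply: (square_sum (op := fun A B => (A \o B)%VF)) => [B a A A'|A a B B'|i|i j ij].
  - by rewrite comp_lfunDl comp_lfunZl.
  - by rewrite comp_lfunDr comp_lfunZr.
  - rewrite comp_lfunA -(comp_lfunA (phi i)) (star_hom_adj_comp (ph i) (pn i)).
    by rewrite -comp_lfunZr -comp_lfunZl comp_lfun1r.
  rewrite comp_lfunA -(comp_lfunA (phi i)) independent_adj_comp //; last exact: pi.
  exact: star_hom_opJ.
have schurBl (A A' B : 'End(Y)) c : schur (A - c *: A') B = schur A B - c *: schur A' B.
  by have := schur_linearl B (- c) A' A; rewrite !scaleNr ![- _ + _]addrC.
have schurBr (A A' B : 'End(Y)) c : schur B (A - c *: A') = schur B A - c *: schur B A'.
  by have := schur_linearr B (- c) A' A; rewrite !scaleNr ![- _ + _]addrC.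
split; first split.
- rewrite schurBl !schurBr schurTT schurTI schurIT schurII.
  rewrite subrr scaler0 subr0 scalerA -addrA -scalerBl -scaleNr.
  by congr (_ + _ *: _); ring.
- apply/lfunP => y; rewrite op_conjE !add_lfunE !opp_lfunE !scale_lfunE !id_lfunE.
  rewrite starD -scaleNr starZ starK rmorphN /= conjC_nat scaleNr; congr (_ - _).
  rewrite !sum_lfunE star_sum; apply: eq_bigr => i _.
  by rewrite -op_conjE op_conj_star_hom.
- symmetry; apply: adj_unique => x y.
  rewrite !add_lfunE !opp_lfunE !scale_lfunE !id_lfunE innerDr innerDl.
  rewrite -!scaleNr innerZr innerZl rmorphN /= conjC_nat; congr (_ + _).
  rewrite !sum_lfunE inner_suml linear_sum; apply: eq_bigr => i _ /=.
  by rewrite !comp_lfunE -adjP adjP'.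
- by rewrite schurBl schurTI schurII subrr.
- by rewrite schurBr schurIT schurII subrr.
- by rewrite eta_dag_eta dY /n eta_dagE -[RHS]psi_tens -eta_dagE -eta_dag_eta.
rewrite comp_lfunDl !comp_lfunDr compTT !comp_lfunNl !comp_lfunNr.
rewrite -!comp_lfunZl -!comp_lfunZr !comp_lfun1l comp_lfun1r.
(* Coordinates with respect to T, I and J reduce the identity to scalar ones. *)
have [v [vD vN vZ [vT vI vJ]]] : exists v : C -> C -> C -> 'End(Y),
    [/\ forall x y z x' y' z', v x y z + v x' y' z' = v (x + x') (y + y') (z + z'),
        forall x y z, - v x y z = v (- x) (- y) (- z),
        forall c x y z, c *: v x y z = v (c * x) (c * y) (c * z)
      & [/\ T = v 1 0 0, opI = v 0 1 0 & opJ = v 0 0 1]].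
  exists (fun x y z => x *: T + y *: opI + z *: opJ); split.
  - by move=> *; rewrite !scalerDl addrACA; congr (_ + _); rewrite addrACA.
  - by move=> *; rewrite !opprD !scaleNr.
  - by move=> *; rewrite !scalerDr !scalerA.
  - by rewrite !scale1r !scale0r !addr0 !add0r.
rewrite vT vI vJ !(vZ, vN, vD); congr (v _ _ _); ring.
Qed.
End OrthogonalArray.

(** * The two coordinates of the product of X with itself *)

Section Coordinates.
Variables (C : numClosedFieldType) (X : finQSpaceType C).

Fact tens1r_linear : linear (fun x : X => x \ox (1 : X)).
Proof. by move=> a x y; rewrite tensDl tensZl. Qed.

Fact tens1l_linear : linear (fun x : X => (1 : X) \ox x).
Proof. by move=> a x y; rewrite tensDr tensZr. Qed.

Definition coord1 : 'Hom(X, tensor X X) :=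
  linfun (HB.pack (fun x : X => x \ox (1 : X))
    (GRing.isLinear.Build C X (tensor X X) _ _ tens1r_linear)
    : {linear X -> tensor X X}).

Definition coord2 : 'Hom(X, tensor X X) :=
  linfun (HB.pack (fun x : X => (1 : X) \ox x)
    (GRing.isLinear.Build C X (tensor X X) _ _ tens1l_linear)
    : {linear X -> tensor X X}).

Lemma coord1E x : coord1 x = x \ox 1. Proof. by rewrite lfunE. Qed.
Lemma coord2E x : coord2 x = 1 \ox x. Proof. by rewrite lfunE. Qed.

Lemma coord1_star_hom : star_hom coord1.
Proof.
split=> [|x y|x]; rewrite !coord1E //; first by rewrite tensM mulr1.
by rewrite star_tens star1.
Qed.

Lemma coord2_star_hom : star_hom coord2.
Proof.
split=> [|x y|x]; rewrite !coord2E //; first by rewrite tensM mulr1.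
by rewrite star_tens star1.
Qed.

Lemma coord12_independent : independent coord1 coord2.
Proof. by move=> a b; rewrite coord1E coord2E tensM mulr1 mul1r psi_tens. Qed.

Lemma tens_opI_opJ : (opI \ox opJ)%VF = (coord1 \o adj coord1)%VF.
Proof.
apply: eq_tens_lfun => x y; rewrite tensfE id_lfunE opJE comp_lfunE coord1E.
rewrite tensZr -tensZl; congr (_ \ox _); apply: inner_nondeg => z.
by rewrite adjP coord1E inner_tens innerZr mulrC.
Qed.

Lemma tens_opJ_opI : (opJ \ox opI)%VF = (coord2 \o adj coord2)%VF.
Proof.
apply: eq_tens_lfun => x y; rewrite tensfE id_lfunE opJE comp_lfunE coord2E.
rewrite tensZl -tensZr; congr (_ \ox _); apply: inner_nondeg => z.
by rewrite adjP coord2E inner_tens innerZr.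
Qed.
End Coordinates.

(** * The symbol map of a quantum Latin square *)

Section LatinSquare.
Variables (C : numClosedFieldType) (X : finQSpaceType C).
Variable L : 'Hom(tensor X X, X).
Hypothesis hL : quantum_latin_square X L.

(** Taking adjoints turns the coalgebra axioms of L into algebra axioms: the
    counit gives unitality, and the comultiplication axiom becomes
    L^dag m = m (L^dag (x) L^dag) for the multiplication of X x X. *)
Lemma qls_adj_star_hom : star_hom (adj L).
Proof.
split.
- apply: inner_ext_tens => x y.
  rewrite adjP -tens1 inner_tens !(innerC 1) -rmorphM.
  by have := qls_counit hL x y; rewrite /eta_dag /eta => ->.
- move=> a b.
  have /(congr1 (@adj _ _ _)) := qls_comul hL.
  rewrite !adj_comp !adj_tensf !adjK adj_midswap.
  rewrite comp_lfunA -mul_lfun_tens => /(congr1 (fun h => fun_of_lfun h (a \ox b))).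
  by rewrite /= !comp_lfunE tensfE !mul_lfunE.
- apply: adj_star; elim/tens_ind => [|M N IM IN|x y].
  + by rewrite star0 !linear0 star0.
  + by rewrite starD !linearD starD /= IM IN.
  + by rewrite star_tens (qls_star hL).
Qed.

(** psi (L^dag a * (b (x) 1)) = <L (star b (x) 1), a>, and L (x (x) eta) is the scalar
    multiple psi x of eta. *)
Lemma qls_independent1 : independent (adj L) (coord1 X).
Proof.
move=> a b; rewrite psiC coord1E -[b \ox 1]starK -/(inner _ _) adjP.
rewrite star_tens star1 (qls_eta_r hL) innerZl eta_dagE psi_star conjCK mulrC.
by rewrite -/(eta_dag _) eta_dagE.
Qed.

Lemma qls_independent2 : independent (adj L) (coord2 X).
Proof.
move=> a b; rewrite psiC coord2E -[1 \ox b]starK -/(inner _ _) adjP.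
rewrite star_tens star1 (qls_eta_l hL) innerZl eta_dagE psi_star conjCK mulrC.
by rewrite -/(eta_dag _) eta_dagE.
Qed.
End LatinSquare.

(** * The Latin square graph *)

Lemma sum_ord3 (V : nmodType) (S : 'I_3 -> V) :
  \sum_i S i = S ord0 + S (lift ord0 ord0) + S ord_max.
Proof.
rewrite !big_ord_recl big_ord0 addr0 addrA.
by congr (_ + _ + S _); apply: val_inj.
Qed.

Local Open Scope complex_scope.

Theorem proposition4p41 (R : realType) (X : finQSpaceType R[i])
    (L : 'Hom(tensor X X, X)) (hL : quantum_latin_square X L) :
  let n : R[i] := eta_dag (eta : X) in
  let I : 'End(X) := opI in
  let J : 'End(X) := opJ in
  let A : 'End(tensor X X) :=
    (I \ox J)%VF + (J \ox I)%VF + (adj L \o L)%VF - 3 *: (I \ox I)%VF in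
  strongly_regular_quantum_graph (tensor X X) A (n ^+ 2) (3 * (n - 1)) n 6.
Proof.
move=> n I J A.
pose phi (i : 'I_3) : 'Hom(X, tensor X X) :=
  match val i with 0 => coord1 X | 1 => coord2 X | _ => adj L end.
have phi_hom i : star_hom (phi i).
  case: i => -[|[|[|//]]] i3; [exact: coord1_star_hom|exact: coord2_star_hom|].
  exact: qls_adj_star_hom.
have phi_indep i j : i != j -> independent (phi i) (phi j).
  case: i j => -[|[|[|//]]] i3 [[|[|[|//]]] j3] //= _.
  - exact: coord12_independent.
  - exact/independentC/qls_independent1.
  - exact/independentC/coord12_independent.
  - exact/independentC/qls_independent2.
  - exact: qls_independent1.
  - exact: qls_independent2.
have phi_psi i a : psi (phi i a) = n * psi a.
  (* Any index other than i serves as the second map, for instance i + 1 mod 3. *)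
  by apply: (independent_psi _ (phi_hom (ordS i)) (phi_indep i (ordS i) _)); case: i => -[|[|[]]].
have phi_sum : \sum_i (phi i \o adj (phi i))%VF =
    (I \ox J)%VF + (J \ox I)%VF + (adj L \o L)%VF.
  have phi1 : phi (lift ord0 ord0) = coord2 X by [].
  have phi2 : phi ord_max = adj L by [].
  by rewrite sum_ord3 phi1 phi2 adjK tens_opI_opJ tens_opJ_opI.
have := orthogonal_array_srg (erefl _) phi_hom phi_psi phi_indep.
rewrite phi_sum -/n => srg.
have lambdaE : n - 2 + (3%:R - 1) * (3%:R - 2) = n by ring.
have muE : 3%:R * (3%:R - 1) = 6 :> R[i] by ring.
by move: srg; rewrite lambdaE muE /opI -tensf1.
Qed.
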